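(* Let $N,n,m,p$ be positive integers, $A\in\mathbb R^{n\times n}$, $B\in\mathbb R^{n\times m}$, $C\in\mathbb R^{p\times n}$, $\Sigma=(A,B,C)$. Suppose that $(\hat P,\hat{\mathcal J},\hat{\mathcal G})$ is a solution of the state-feedback LMI $$\mathcal X_N(P,1)+\mathrm{He}\left\{(\mathcal L_N^T\otimes A)\mathcal G(\mathcal R_N\otimes\mathbf I_n)+(\mathcal L_N^T\otimes B)\mathcal J(\mathcal R_N\otimes\mathbf I_n)-(\mathcal R_N^T\otimes\mathbf I_n)\mathcal G(\mathcal R_N\otimes\mathbf I_n)\right\}\prec0$$ in the unknowns $P=P^T\in\mathbb R^{n\times n}$, $\mathcal J\in\mathbb R^{Nm\times Nn}$ block upper triangular with $m\times n$ blocks, and $\mathcal G\in\mathbb R^{Nn\times Nn}$ block upper triangular with $n\times n$ blocks, and let $\hat{\mathcal F}_{\mathrm{SF}}=(\mathbf T_N\otimes\mathbf I_m)\hat{\mathcal J}\hat{\mathcal G}^{-1}(\mathbf T_N\otimes\mathbf I_n)$. Then there exist $P=P^T\in\mathbb R^{n\times n}$, $\mathcal V\in\mathbb R^{((N-1)n+Nm)\times((N-1)n+Nm)}$ and a structured output-feedback gain matrix $\mathcal F_{\mathrm{SOF}}\in\mathbb R^{Nm\times Np}$ such that $$P\succ0,\qquad \Pi_N^T\,\mathcal X_N(P,1)\,\Pi_N+\mathrm{He}\{M\,\mathcal C(\mathcal F_{\mathrm{SOF}})\}\prec0\quad\text{with } M=\mathcal H(\hat{\mathcal F}_{\mathrm{SF}})^T\mathcal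 V$$ if and only if $$\mathcal P\bigl(\mathcal A_{\mathrm{LTI}}(\hat{\mathcal F}_{\mathrm{SF}},\Sigma)\bigr)\cap\mathcal S_{\mathrm{SOF}}^{(N)}(\Sigma)\neq\emptyset .$$
   Context: Notation: $\mathrm{He}\{X\}=X^T+X$; $\rho$ is the spectral radius; $\otimes$ is the Kronecker product; $\mathbf I_q$ is the $q\times q$ identity; $\mathbf 0$ is a zero matrix of appropriate size; $\mathbf e_{(q,i)}\in\mathbb R^q$ is the $i$-th standard unit column vector; $\mathbb S_+^n$ is the set of real symmetric positive definite $n\times n$ matrices; $\succ0$ ($\prec0$) means symmetric positive (negative) definite. $\mathcal L_q=[\mathbf I_q\ \ \mathbf 0_q]$ and $\mathcal R_q=[\mathbf 0_q\ \ \mathbf I_q]$, both in $\mathbb R^{q\times(q+1)}$, with $\mathbf 0_q$ the zero column vector (for $q=0$ these are empty and the corresponding blocks are absent). $\mathbf T_N\in\mathbb R^{N\times N}$ is the exchange matrix (ones on the anti-diagonal, zeros elsewhere). Any $\hat{\mathcal G}$ in a solution of the state-feedback LMI is invertible. Structured output-feedback (respectively state-feedback) gain matrix: a block lower triangular matrix collecting gains $F^{(k,i)}$, $0\le i\le k\le N-1$, of size $m\times p$ (respectively $m\times n$), $$\mathcal F=\begin{bmatrix}F^{(0,0)}&\mathbf 0&\cdots&\mathbf 0\\ F^{(1,1)}&F^{(1,0)}&\ddots&\vdots\\ \vdots&\ddots&\ddots&\mathbf 0\\ F^{(N-1,N-1)}&\cdots&F^{(N-1,1)}&F^{(N-1,0)}\end{bmatrix}.$$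 The matrix $\hat{\mathcal F}_{\mathrm{SF}}$ is a structured state-feedback gain matrix. For a structured gain matrix $\mathcal F$, $\mathcal A_{\mathrm{LTI}}(\mathcal F,\Sigma)=\Phi_N\in\mathbb R^{n\times n}$, where $\Phi_0=\mathbf I_n$ and, for $\delta=1,\dots,N$, $\Phi_\delta=A\Phi_{\delta-1}+B\sum_{i=0}^{\delta-1}F^{(\delta-1,i)}C\,\Phi_{\delta-1-i}$ for an output-feedback gain matrix, and the same recursion with $C$ replaced by $\mathbf I_n$ for a state-feedback gain matrix. (It maps $x(k)$ to $x(k+N)$, for $k$ divisible by $N$, along the closed loop of $x(k+1)=Ax(k)+Bu(k)$, $y(k)=Cx(k)$ with $u(k)=\sum_{i=0}^{\lceil k\rceil_N}F^{(\lceil k\rceil_N,i)}y(k-i)$, respectively with $x(k-i)$ in place of $y(k-i)$, $\lceil k\rceil_N$ being the remainder of $k$ divided by $N$.) For a matrix $X\in\mathbb R^{n\times n}$ with $\rho(X)<1$, $\mathcal P(X)=\{P\in\mathbb S_+^n: X^TPX-P\prec0\}$. $\mathcal L_{\mathrm{SOF}}^{(N)}(\Sigma)$ is the set of structured output-feedback gain matrices $\mathcal F\in\mathbb R^{Nm\times Np}$ with $\rho(\mathcal A_{\mathrm{LTI}}(\mathcal F,\Sigma))<1$, and $\mathcal S_{\mathrm{SOF}}^{(N)}(\Sigma)=\bigcup_{\mathcal F\in\mathcal L_{\mathrm{SOF}}^{(N)}(\Sigma)}\mathcal P(\mathcal A_{\mathrm{LTI}}(\mathcal F,\Sigma))$.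 Further matrices: $$\mathcal X_N(P,\gamma)=\bigl(-\gamma\,\mathbf e_{(N+1,1)}\mathbf e_{(N+1,1)}^T+\mathbf e_{(N+1,N+1)}\mathbf e_{(N+1,N+1)}^T\bigr)\otimes P,$$ $$\Pi_N=\begin{bmatrix}\mathbf e_{(N,1)}^T\otimes\mathbf I_n&\mathbf 0_{n\times Nm}\\ \mathbf I_N\otimes A&\mathbf I_N\otimes B\end{bmatrix},$$ $$\mathcal C(\mathcal F)=\begin{bmatrix}\mathcal F(\mathbf I_N\otimes C)&-\mathbf I_N\otimes\mathbf I_m\\ \mathcal L_{N-1}\otimes A-\mathcal R_{N-1}\otimes\mathbf I_n&\mathcal L_{N-1}\otimes B\end{bmatrix},$$ $$\mathcal H(\hat{\mathcal F}_{\mathrm{SF}})=\begin{bmatrix}\hat{\mathcal F}_{\mathrm{SF}}&-\mathbf I_N\otimes\mathbf I_m\\ \mathcal L_{N-1}\otimes A-\mathcal R_{N-1}\otimes\mathbf I_n&\mathcal L_{N-1}\otimes B\end{bmatrix}.$$ *)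

(* Defs.v *)
From HB Require Import structures.
From mathcomp Require Import all_boot all_order all_algebra.
From mathcomp Require Import complex mxtens.
From mathcomp Require Import boolp classical_sets reals.

Set Implicit Arguments.
Unset Strict Implicit.
Unset Printing Implicit Defensive.

Import Order.TTheory GRing.Theory Num.Theory.
Local Open Scope classical_set_scope.
Local Open Scope ring_scope.

(* All matrices are indexed from 0, and a matrix with r x c blocks of size
   m x p has type 'M_(r * m, c * p), with the row-major indexing of the
   Kronecker product [*t].  Whenever the period N must be positive, it is
   written K.+1, so that N - 1 is K. *)

Section Matrices.
Variable R : realType.

Definition He d (X : 'M[R]_d) : 'M[R]_d := X^T + X.

Definition posdef d (X : 'M[R]_d) : Prop :=
  X^T = X /\ forall v : 'cV[R]_d, v != 0 -> 0 < (v^T *m X *m v) 0 0.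

Definition negdef d (X : 'M[R]_d) : Prop :=
  X^T = X /\ forall v : 'cV[R]_d, v != 0 -> (v^T *m X *m v) 0 0 < 0.

(* The largest modulus of a complex eigenvalue.  For d > 0 the set is finite
   and nonempty, so that the supremum is a maximum. *)
Definition spectral_radius d (X : 'M[R]_d) : R :=
  sup [set ComplexField.Normc.normc l | l in
        [set l : R[i] | eigenvalue (map_mx (real_complex R) X) l]].

Definition evec d (i : 'I_d) : 'cV[R]_d := delta_mx i 0.

(* [I_q  0_q] and [0_q  I_q] *)
Definition Lmx q : 'M[R]_(q, q.+1) :=
  \matrix_(i < q, j < q.+1) (j == i :> nat)%:R.
Definition Rmx q : 'M[R]_(q, q.+1) :=
  \matrix_(i < q, j < q.+1) (j == i.+1 :> nat)%:R.

Definition exchange N : 'M[R]_N := \matrix_(i < N, j < N) (j == rev_ord i)%:R.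

Definition blk r c m p (F : 'M[R]_(r * m, c * p)) (k : 'I_r) (j : 'I_c) :
    'M[R]_(m, p) :=
  \matrix_(a < m, b < p) F (mxtens_index (k, a)) (mxtens_index (j, b)).

Definition block_lower N m p (F : 'M[R]_(N * m, N * p)) : Prop :=
  forall k j : 'I_N, (k < j)%N -> blk F k j = 0.

Definition block_upper N m p (F : 'M[R]_(N * m, N * p)) : Prop :=
  forall k j : 'I_N, (j < k)%N -> blk F k j = 0.

(* F^(k,i) is the block in block row k and block column k - i; it is
   meaningful for i <= k < N = K.+1, the only case in which it is used. *)
Definition gain K m p (F : 'M[R]_(K.+1 * m, K.+1 * p)) (k i : nat) :
    'M[R]_(m, p) :=
  blk F (inord k) (inord (k - i)).

Section Plant.
Variables n m p : nat.
Variables (A : 'M[R]_n) (B : 'M[R]_(n, m)) (C : 'M[R]_(p, n)).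

Section Closed_loop.
Variables (K : nat) (F : 'M[R]_(K.+1 * m, K.+1 * p)).

(* The reversed history [:: Phi_d; ...; Phi_0], whose i-th entry is
   Phi_(d - i). *)
Fixpoint Phi_hist (d : nat) : seq 'M[R]_n :=
  if d is d'.+1 then
    let h := Phi_hist d' in
    (A *m h`_0 + B *m \sum_(0 <= i < d) gain F d' i *m C *m h`_i) :: h
  else [:: 1%:M].

Definition Phi (d : nat) : 'M[R]_n := (Phi_hist d)`_0.

Lemma Phi_histE d i : (i <= d)%N -> (Phi_hist d)`_i = Phi (d - i).
Proof.
elim: d i => [|d IHd] [|i] //= le_id.
by rewrite subSS; exact: IHd.
Qed.

Lemma Phi0 : Phi 0 = 1%:M.
Proof. by []. Qed.

Lemma PhiS d :
  Phi d.+1 =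
    A *m Phi d + B *m \sum_(0 <= i < d.+1) gain F d i *m C *m Phi (d - i).
Proof.
rewrite {1}/Phi [Phi_hist d.+1]/=; congr (_ + B *m _).
by apply: eq_big_nat => i /= lt_id; rewrite Phi_histE.
Qed.

(* State feedback is the case C = 1%:M (with p = n). *)
Definition A_LTI : 'M[R]_n := Phi K.+1.

End Closed_loop.

(* Only applied to matrices X with spectral_radius X < 1, so that this
   condition is not repeated in the definition. *)
Definition Pset (X : 'M[R]_n) : set 'M[R]_n :=
  [set P | posdef P /\ negdef (X^T *m P *m X - P)].

Definition L_SOF K : set 'M[R]_(K.+1 * m, K.+1 * p) :=
  [set F | block_lower F /\ spectral_radius (A_LTI F) < 1].

Definition S_SOF K : set 'M[R]_n := \bigcup_(F in @L_SOF K) Pset (A_LTI F).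

Definition X_mx N (P : 'M[R]_n) (g : R) : 'M[R]_(N.+1 * n) :=
  (- (g *: (evec ord0 *m (evec ord0)^T)) + evec ord_max *m (evec ord_max)^T)
    *t P.

(* The cast identifies the number of rows 1 * n + N * n with (1 + N) * n. *)
Definition Pi_mx K : 'M[R]_(K.+2 * n, K.+1 * n + K.+1 * m) :=
  castmx (esym (mulnDl 1 K.+1 n), erefl)
    (block_mx ((evec (@ord0 K))^T *t (1%:M : 'M[R]_n)) 0
              (1%:M *t A)                            (1%:M *t B)).

Definition C_mx K (F : 'M[R]_(K.+1 * m, K.+1 * p)) :
    'M[R]_(K.+1 * m + K * n, K.+1 * n + K.+1 * m) :=
  block_mx (F *m (1%:M *t C))            (- (1%:M *t 1%:M))
           (Lmx K *t A - Rmx K *t 1%:M)  (Lmx K *t B).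

Definition H_mx K (F : 'M[R]_(K.+1 * m, K.+1 * n)) :
    'M[R]_(K.+1 * m + K * n, K.+1 * n + K.+1 * m) :=
  block_mx F                             (- (1%:M *t 1%:M))
           (Lmx K *t A - Rmx K *t 1%:M)  (Lmx K *t B).

Definition sf_LMI_solution N (P : 'M[R]_n) (J : 'M[R]_(N * m, N * n))
    (G : 'M[R]_(N * n)) : Prop :=
  [/\ P^T = P, block_upper J, block_upper G &
      negdef (X_mx N P 1 +
        He (((Lmx N)^T *t A) *m G *m (Rmx N *t 1%:M)
            + ((Lmx N)^T *t B) *m J *m (Rmx N *t 1%:M)
            - ((Rmx N)^T *t 1%:M) *m G *m (Rmx N *t 1%:M)))].

End Plant.

(* G is invertible for every solution of the LMI, so that [invmx G] is its
   inverse. *)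
Definition sf_gain N n m (J : 'M[R]_(N * m, N * n)) (G : 'M[R]_(N * n)) :
    'M[R]_(N * m, N * n) :=
  (exchange N *t 1%:M) *m J *m invmx G *m (exchange N *t 1%:M).

End Matrices.

(* Main.v *)
Require Import Defs.
From HB Require Import structures.
From mathcomp Require Import all_boot all_order all_algebra.
From mathcomp Require Import complex mxtens.
From mathcomp Require Import boolp classical_sets reals.
From mathcomp Require Import lra.

Set Implicit Arguments.
Unset Strict Implicit.
Unset Printing Implicit Defensive.

Import Order.TTheory GRing.Theory Num.Theory.
Local Open Scope classical_set_scope.
Local Open Scope ring_scope.

(** Write Q for the matrix Pi^T X(P,1) Pi, and z = (x_0, ..., x_{N-1}, u_0, ...,
u_{N-1}) for a vector of states and inputs over one period.  The bottom rows of
C(F) z = 0 are the state equations x_{k+1} = A x_k + B u_k, and its top rows are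
the feedback law u = F (I *t C) x.  When F is block lower triangular the law is
causal, so the kernel of C(F) consists of the trajectories of the closed loop
over one period, one for each initial state x_0 ([kernelE],
[kernel_trajectory]).  On the trajectory that starts at x_0, Q takes the value
x_0^T (Phi_N^T P Phi_N - P) x_0 ([form_trajectory]).  Hence P satisfies the
Lyapunov inequality for A_LTI(F) exactly when Q is negative on the kernel of
C(F) ([neg_on_kernelP]).  As H(F) is C(F) for the plant with C = I
([H_mxE]), the same holds for the state-feedback gain.  That gain is block lower
triangular because block upper triangular matrices are closed under products
and inverses, and conjugation by the exchange matrix reverses the order of the
blocks ([block_lower_sf_gain]).

The theorem is now the projection lemma: for a symmetric matrix Q and matrices H
and D, there is a V with Q + He(H^T V D) negative definite if and only if Q is
negative on the kernel of H and on the kernel of D.  Necessity is immediate, since the added term vanishes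
on both kernels.  Sufficiency ([projection_lemma]) is proved with an explicit V,
which depends on the constant of Finsler's lemma ([finsler]).

The set S_SOF moreover asks that the spectral radius of A_LTI(F) be less than 1.
This follows from the Lyapunov inequality with P positive definite
([lyapunov_spectral_radius]). *)

(** * Quadratic forms and the projection lemma *)

Section QuadraticForms.
Variable R : realType.

Definition dot d (u v : 'cV[R]_d) : R := (u^T *m v) 0 0.

Lemma dotE d (u v : 'cV[R]_d) : dot u v = \sum_i u i 0 * v i 0.
Proof. by rewrite /dot mxE; apply: eq_bigr => i _; rewrite mxE. Qed.

Lemma dotC d (u v : 'cV[R]_d) : dot u v = dot v u.
Proof. by rewrite !dotE; apply: eq_bigr => i _; rewrite mulrC. Qed.

Lemma dotDr d (u v w : 'cV[R]_d) : dot u (v + w) = dot u v + dot u w.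
Proof. by rewrite /dot mulmxDr mxE. Qed.

Lemma dotDl d (u v w : 'cV[R]_d) : dot (u + v) w = dot u w + dot v w.
Proof. by rewrite dotC dotDr !(dotC w). Qed.

Lemma dotNr d (u v : 'cV[R]_d) : dot u (- v) = - dot u v.
Proof. by rewrite /dot mulmxN mxE. Qed.

Lemma dotNl d (u v : 'cV[R]_d) : dot (- u) v = - dot u v.
Proof. by rewrite dotC dotNr dotC. Qed.

Lemma dotZr d (u v : 'cV[R]_d) a : dot u (a *: v) = a * dot u v.
Proof. by rewrite /dot -scalemxAr mxE. Qed.

Lemma dotZl d (u v : 'cV[R]_d) a : dot (a *: u) v = a * dot u v.
Proof. by rewrite dotC dotZr dotC. Qed.

Lemma dot0r d (u : 'cV[R]_d) : dot u 0 = 0.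
Proof. by rewrite /dot mulmx0 mxE. Qed.

Lemma dot0l d (u : 'cV[R]_d) : dot 0 u = 0.
Proof. by rewrite dotC dot0r. Qed.

Lemma dot_mull d e (M : 'M[R]_(d, e)) u v : dot (M *m u) v = dot u (M^T *m v).
Proof. by rewrite /dot trmx_mul mulmxA. Qed.

Lemma dot_ge0 d (u : 'cV[R]_d) : 0 <= dot u u.
Proof. by rewrite dotE sumr_ge0 // => i _; rewrite -expr2 sqr_ge0. Qed.

Lemma dot_gt0 d (u : 'cV[R]_d) : u != 0 -> 0 < dot u u.
Proof.
move=> u0; rewrite lt_neqAle dot_ge0 andbT eq_sym; apply: contra u0.
rewrite dotE psumr_eq0 => [/allP u0|i _]; last by rewrite -expr2 sqr_ge0.
apply/eqP/colP => i; rewrite mxE; apply/eqP.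
by have := u0 i (mem_index_enum i); rewrite /= mulf_eq0 orbb.
Qed.

Lemma posdefP d (X : 'M[R]_d) :
  posdef X <-> X^T = X /\ forall v, v != 0 -> 0 < dot v (X *m v).
Proof.
by rewrite /posdef /dot; split=> -[? h]; split=> // v /h; rewrite mulmxA.
Qed.

Lemma negdefP d (X : 'M[R]_d) :
  negdef X <-> X^T = X /\ forall v, v != 0 -> dot v (X *m v) < 0.
Proof.
by rewrite /negdef /dot; split=> -[? h]; split=> // v /h; rewrite mulmxA.
Qed.

Lemma posdef_ge0 d (X : 'M[R]_d) v : posdef X -> 0 <= dot v (X *m v).
Proof.
move=> /posdefP[_ h]; have [->|/h/ltW//] := eqVneq v 0.
by rewrite dot0l.
Qed.

Lemma dot_sym d (X : 'M[R]_d) u v : X^T = X -> dot u (X *m v) = dot v (X *m u).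
Proof. by move=> sX; rewrite dotC dot_mull sX. Qed.

Lemma posdef_unitmx d (X : 'M[R]_d) : posdef X -> X \in unitmx.
Proof.
move=> /posdefP[sX h]; rewrite -row_free_unit -kermx_eq0; apply/rowV0P => v.
move=> /sub_kermxP vX; apply/eqP/negPn/negP => v0.
have := h v^T; rewrite trmx_eq0 -{1}sX -trmx_mul vX trmx0 dot0r ltxx.
by move=> /(_ v0).
Qed.

Lemma form_le_norm d (M : 'M[R]_d) :
  exists c, forall v, dot v (M *m v) <= c * dot v v.
Proof.
exists (\sum_i \sum_j `|M i j|) => v.
have le_v i : v i 0 ^+ 2 <= dot v v.
  rewrite dotE (bigD1 i) //= -expr2 lerDl sumr_ge0 // => j _.
  by rewrite -expr2 sqr_ge0.
rewrite {1}dotE mulr_suml ler_sum // => i _.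
rewrite mxE mulr_sumr mulr_suml ler_sum // => j _.
rewrite mulrCA (le_trans (ler_norm _)) // normrM ler_wpM2l ?normr_ge0 //.
have := le_v i; have := le_v j; rewrite ler_norml; nra.
Qed.

(** When Q is negative on the kernel of C, its restriction to that kernel is
nondegenerate, so the space is the sum of the kernel and of its Q-orthogonal
complement, on which C is injective.  Here N is a basis of the kernel and L C is
the projection onto the complement. *)
Lemma orthogonal_section d s (Q : 'M[R]_d) (C : 'M[R]_(s, d)) :
    Q^T = Q -> (forall z : 'cV_d, z != 0 -> C *m z = 0 -> dot z (Q *m z) < 0) ->
  exists k (N : 'M[R]_(d, k)) (L : 'M[R]_(d, s)),
    [/\ C *m N = 0, posdef (- (N^T *m Q *m N)), N^T *m Q *m L *m C = 0 &
        forall z : 'cV_d, exists x, z = L *m (C *m z) + N *m x].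
Proof.
move=> sQ Qneg; pose N := col_base (cokermx C); pose r := row_base (cokermx C).
have defN : N *m r = cokermx C by exact: mulmx_base.
have CN : C *m N = 0.
  apply/eqP; rewrite -(mulmx_free_eq0 _ (row_base_free (cokermx C))) -mulmxA.
  by rewrite defN mulmx_coker.
have injN (x : 'cV_ _) : N *m x = 0 -> x = 0.
  move=> Nx0; have /row_fullP[N' N'N] := col_base_full (cokermx C).
  by rewrite -[x]mul1mx -N'N -mulmxA Nx0 mulmx0.
move: N r defN CN injN => N r defN CN injN; pose a := - (N^T *m Q *m N).
have pa : posdef a.
  apply/posdefP; split=> [|x x0].
    by rewrite /a linearN /= !trmx_mul trmxK sQ mulmxA.
  rewrite /a mulNmx dotNr oppr_gt0 -!mulmxA -dot_mull.
  rewrite Qneg ?mulmxA ?CN ?mul0mx //.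
  by apply: contra x0 => /eqP/injN->.
have ua := posdef_unitmx pa.
(* p is the Q-orthogonal projection along the kernel; it kills the kernel, so
   it factors through C. *)
pose p := 1%:M + N *m invmx a *m N^T *m Q.
have pN : p *m N = 0.
  rewrite mulmxDl mul1mx -!mulmxA (mulmxA _ Q) -[_ *m N]opprK -/a.
  by rewrite mulmxN mulVmx // mulmxN mulmx1 subrr.
have /submxP[L defp] : (p <= C)%MS by rewrite submxE -defN mulmxA pN mul0mx.
exists _, N, L; split=> // [|z].
  rewrite -mulmxA -defp mulmxDr mulmx1 !mulmxA -(opprK (N^T *m Q *m N)) -/a.
  by rewrite 3!mulNmx mulmxV // mul1mx subrr.
exists (- (invmx a *m N^T *m Q *m z)).
by rewrite (mulmxA L) -defp mulmxDl mul1mx mulmxN !mulmxA addrK.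
Qed.

Lemma form_orthD d k (Q : 'M[R]_d) (N : 'M[R]_(d, k)) (y : 'cV_d) (x : 'cV_k) :
    Q^T = Q -> N^T *m Q *m y = 0 ->
  dot (y + N *m x) (Q *m (y + N *m x)) =
    dot y (Q *m y) - dot x (- (N^T *m Q *m N) *m x).
Proof.
move=> sQ o; have o' : dot (N *m x) (Q *m y) = 0.
  by rewrite dot_mull mulmxA o dot0r.
rewrite mulmxDr !(dotDl, dotDr) (dot_sym y _ sQ) o' addr0 add0r; congr (_ + _).
by rewrite dot_mull mulNmx dotNr opprK !mulmxA.
Qed.

(** Finsler's lemma.  In the Q-orthogonal decomposition along the kernel of H,
the kernel part contributes a nonpositive term, and the rest of Q depends on
H z alone, so that it is at most a constant times the squared norm of H z. *)
Lemma finsler d r (Q : 'M[R]_d) (H : 'M[R]_(r, d)) :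
    Q^T = Q -> (forall z : 'cV_d, z != 0 -> H *m z = 0 -> dot z (Q *m z) < 0) ->
  exists2 t, 0 < t & forall z : 'cV_d, z != 0 ->
    dot z (Q *m z) < t * dot (H *m z) (H *m z).
Proof.
move=> sQ Qneg; have [k [N [L [HN pa o split]]]] := orthogonal_section sQ Qneg.
have [c le_c] := form_le_norm (L^T *m Q *m L).
exists (`|c| + 1) => [|z z0]; first by rewrite ltr_wpDl.
have [Hz0|Hz0] := eqVneq (H *m z) 0; first by rewrite Hz0 dot0r mulr0 Qneg.
have [x zE] := split z; rewrite {1 2}zE.
rewrite form_orthD //; last by rewrite !mulmxA o mul0mx.
have := posdef_ge0 x pa; have := le_c (H *m z); have := dot_gt0 Hz0.
rewrite -!mulmxA -dot_mull; have := ler_norm c; nra.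
Qed.

Lemma form_addHe d r s (Q : 'M[R]_d) (H : 'M[R]_(r, d)) (V : 'M[R]_(r, s))
    (C : 'M[R]_(s, d)) z :
  dot z ((Q + He (H^T *m V *m C)) *m z) =
    dot z (Q *m z) + 2 * dot (H *m z) (V *m (C *m z)).
Proof.
rewrite mulmxDl dotDr; congr (_ + _); rewrite /He mulmxDl dotDr -dot_mull.
by rewrite (dotC (_ *m _) z) -!mulmxA -dot_mull mulr_natl mulr2n.
Qed.

(** Let z = y + N x be the Q-orthogonal decomposition along the kernel of C,
with y = L C z, let a = - N^T Q N, h = H N, and let t be the constant of
Finsler's lemma for H.  For v = V C z, the value of Q + He(H^T V C) at z is
Q(y) - a(x) + 2 (H y + h x)^T v, and its maximum over x is attained at
x' = a^-1 h^T v.  This maximum is Q(y) + 2 (H y)^T v + v^T h a^-1 h^T v.  With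
1/t added to h a^-1 h^T, which gives an invertible matrix Y, the choice
V = - Y^-1 H L minimises the result; at z' = L C z + N x' it yields
H z' = - v / t, and what Finsler's lemma asserts at z' is then the bound that is
needed. *)
Lemma projection_lemma d r s (Q : 'M[R]_d) (H : 'M[R]_(r, d))
    (C : 'M[R]_(s, d)) :
    Q^T = Q -> (forall z : 'cV_d, z != 0 -> H *m z = 0 -> dot z (Q *m z) < 0) ->
    (forall z : 'cV_d, z != 0 -> C *m z = 0 -> dot z (Q *m z) < 0) ->
  exists V : 'M[R]_(r, s), negdef (Q + He (H^T *m V *m C)).
Proof.
move=> sQ QnegH QnegC.
have [k [N [L [CN pa o split]]]] := orthogonal_section sQ QnegC.
have [t t_gt0 lt_t] := finsler sQ QnegH.
set a := - _ in pa; have ua := posdef_unitmx pa; have [sa _] := pa.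
have [h hE] : exists h, h = H *m N by exists (H *m N).
pose Y := h *m invmx a *m h^T + t^-1%:M.
have pY : posdef Y.
  apply/posdefP; split=> [|v v0].
    by rewrite /Y linearD /= tr_scalar_mx !trmx_mul trmxK trmx_inv sa mulmxA.
  rewrite mulmxDl mul_scalar_mx dotDr dotZr ltr_wpDl //.
    have := posdef_ge0 (invmx a *m (h^T *m v)) pa.
    by rewrite mulKVmx // dotC dot_mull trmxK !mulmxA.
  by rewrite mulr_gt0 ?invr_gt0 ?dot_gt0.
have uY := posdef_unitmx pY.
pose V := - (invmx Y *m (H *m L)).
exists V; apply/negdefP; split=> [|z z0].
  by rewrite /He linearD /= sQ linearD /= trmxK (addrC _^T).
have oL : N^T *m Q *m (L *m (C *m z)) = 0 by rewrite !mulmxA o mul0mx.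
rewrite form_addHe; have [Cz0|Cz0] := eqVneq (C *m z) 0.
  by rewrite Cz0 mulmx0 dot0r mulr0 addr0 QnegC.
have [x zE] := split z; set w := C *m z in Cz0 oL zE *; set v := V *m w.
pose x' := invmx a *m (h^T *m v); pose z' := L *m w + N *m x'.
have z'0 : z' != 0.
  apply: contra Cz0 => /eqP z'0; have : C *m z' = C *m z.
    by rewrite {1}zE !mulmxDr !(mulmxA C N) CN !mul0mx.
  by rewrite z'0 mulmx0 -/w => <-.
have HLw : H *m (L *m w) = - (Y *m v).
  by rewrite /v /V mulNmx mulmxN opprK -mulmxA mulKVmx // mulmxA.
have Hz' : H *m z' = - (t^-1 *: v).
  rewrite mulmxDr HLw mulmxA -hE /x' mulmxDl mul_scalar_mx !mulmxA opprD.
  by rewrite addrAC addNr add0r.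
have Hz : H *m z = - (Y *m v) + h *m x by rewrite {1}zE mulmxDr HLw mulmxA hE.
have hx u : dot (h *m u) v = dot u (a *m x').
  by rewrite dot_mull /x' mulKVmx.
have Yv : dot v (Y *m v) = dot x' (a *m x') + t^-1 * dot v v.
  by rewrite -hx /x' mulmxDl dotDr mul_scalar_mx dotZr !mulmxA (dotC _ v).
have := lt_t z' z'0; rewrite Hz' {1 2}/z' form_orthD // -/a.
rewrite dotNl dotNr opprK dotZl dotZr.
rewrite Hz dotDl dotNl (dotC (Y *m v)) Yv hx {1 2}zE form_orthD // -/a.
have := posdef_ge0 (x - x') pa.
rewrite mulmxBr !(dotDl, dotDr, dotNl, dotNr) (dot_sym x' x sa).
rewrite mulVKf ?gt_eqF //.
have : 0 <= t^-1 * dot v v by rewrite mulr_ge0 ?dot_ge0 // invr_ge0 ltW.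
move: (dot x _) (dot x _) (dot x' _) (dot (L *m w) _) (t^-1 * _).
by clear=> x1 x2 x3 x4 x5; lra.
Qed.

End QuadraticForms.

(** * The Lyapunov inequality bounds the spectral radius *)

Section SpectralRadius.
Variable R : realType.

(** An eigenvalue is defined by row vectors, while the Lyapunov inequality acts
on column vectors; a and b are the real and imaginary parts of a column
eigenvector, which exists because X - l and its transpose are singular
together. *)
Lemma eigenvalue_real_pair n (X : 'M[R]_n) (l : R[i]) :
    eigenvalue (map_mx (real_complex R) X) l ->
  exists a b : 'cV[R]_n,
    [/\ (a != 0) || (b != 0),
        X *m a = complex.Re l *: a - complex.Im l *: b &
        X *m b = complex.Re l *: b + complex.Im l *: a].
Proof.
rewrite /eigenvalue /eigenspace kermx_eq0 row_free_unit -unitmx_tr.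
rewrite -row_free_unit -kermx_eq0 => /rowV0Pn[v /sub_kermxP Xv v0].
exists (map_mx (@complex.Re R) v^T), (map_mx (@complex.Im R) v^T).
have eqX i : \sum_j (X i j)%:C%C * v 0 j = l * v 0 i.
  move/(congr1 trmx)/matrixP/(_ i 0): Xv.
  rewrite trmx_mul trmxK mulmxBl mul_scalar_mx trmx0 !mxE.
  by move/eqP; rewrite subr_eq0 => /eqP<-; apply: eq_bigr => j _; rewrite !mxE.
have ReD : {morph @complex.Re R : x y / x + y} by move=> [? ?] [].
have ImD : {morph @complex.Im R : x y / x + y} by move=> [? ?] [].
split.
- apply: contraNT v0; rewrite negb_or !negbK.
  move=> /andP[/eqP/colP a0 /eqP/colP b0].
  apply/eqP/rowP => j; have := a0 j; have := b0 j; rewrite !mxE.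
  by case: (v 0 j) => x y /= -> ->.
- apply/colP => i; rewrite !mxE.
  have := congr1 (@complex.Re R) (eqX i).
  rewrite (big_morph _ ReD (erefl _)) => ReX.
  transitivity (complex.Re (l * v 0 i)); last first.
    by case: l {eqX ReX Xv} (v 0 i) => ? ? [].
  rewrite -ReX; apply: eq_bigr => j _; rewrite !mxE.
  by case: (v 0 j) => x y /=; rewrite mul0r subr0.
- apply/colP => i; rewrite !mxE.
  have := congr1 (@complex.Im R) (eqX i).
  rewrite (big_morph _ ImD (erefl _)) => ImX.
  transitivity (complex.Im (l * v 0 i)); last first.
    by case: l {eqX ImX Xv} (v 0 i) => ? ? [].
  rewrite -ImX; apply: eq_bigr => j _; rewrite !mxE.
  by case: (v 0 j) => x y /=; rewrite mul0r addr0.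
Qed.

(** X multiplies a + i b by l, so it multiplies the sum a^T P a + b^T P b by
|l|^2, while the Lyapunov inequality makes this sum decrease. *)
Lemma lyapunov_eigenvalue n (X P : 'M[R]_n) (l : R[i]) :
    posdef P -> negdef (X^T *m P *m X - P) ->
    eigenvalue (map_mx (real_complex R) X) l ->
  ComplexField.Normc.normc l < 1.
Proof.
move=> /[dup] pP /posdefP[sP _] /negdefP[_ Xdec].
move=> /eigenvalue_real_pair[a [b [ab0 Xa Xb]]].
have lt_dec v : v != 0 -> dot (X *m v) (P *m (X *m v)) < dot v (P *m v).
  move=> /Xdec; rewrite mulmxBl dotDr dotNr subr_lt0.
  by rewrite -!mulmxA -dot_mull.
have le_dec v : dot (X *m v) (P *m (X *m v)) <= dot v (P *m v).
  by have [->|/lt_dec/ltW//] := eqVneq v 0; rewrite mulmx0.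
have lt_sum : dot (X *m a) (P *m (X *m a)) + dot (X *m b) (P *m (X *m b))
    < dot a (P *m a) + dot b (P *m b).
  by case/orP: ab0 => /lt_dec lt_v; [apply: ltr_leD | apply: ler_ltD].
have Pa := posdef_ge0 a pP; have Pb := posdef_ge0 b pP.
move: lt_sum; rewrite Xa Xb !mulmxDr !(mulmxN, scalemxAr, mulmxBr) -?scalemxAr.
rewrite !(dotDl, dotDr, dotNl, dotNr, dotZl, dotZr) (dot_sym b a sP).
move: (dot a (P *m a)) (dot b (P *m b)) (dot a (P *m b)) Pa Pb.
move=> x y z x0 y0 lt_sum.
case: l lt_sum {Xa Xb} => [c d] /= lt_sum.
rewrite -sqrtr1 ltr_sqrt // ltNge; apply/negP => le1.
by move: lt_sum; nra.
Qed.

(** The strict bound survives in the supremum because the set is finite; the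
supremum of the empty set is 0. *)
Lemma sup_finite_lt1 (E : set R) (s : seq R) :
  (forall x, E x -> x \in s) -> (forall x, E x -> x < 1) -> sup E < 1.
Proof.
move=> Es E1; have [[x Ex]|E0] := pselect (E !=set0); last first.
  by rewrite sup_out ?ltr01 // => -[].
apply: (@le_lt_trans _ _ (\big[Num.max/0]_(y <- s | y < 1) y)).
  apply: ge_sup; first by exists x.
  by move=> y Ey; apply: le_bigmax_seq (Es y Ey) (E1 y Ey).
by apply: bigmax_lt; rewrite ?ltr01.
Qed.

Lemma lyapunov_spectral_radius n (X P : 'M[R]_n) :
  posdef P -> negdef (X^T *m P *m X - P) -> spectral_radius X < 1.
Proof.
move=> pP Xdec; set Xc := map_mx (real_complex R) X.
have [rs char_X] := closed_field_poly_normal (char_poly Xc).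
apply: (@sup_finite_lt1 _ [seq ComplexField.Normc.normc l | l <- rs]).
  move=> _ [l + <-]; rewrite /= eigenvalue_root_char char_X => root_l.
  apply: map_f; move: root_l.
  by rewrite (monicP (char_poly_monic _)) scale1r root_prod_XsubC.
by move=> _ [l /= Xl <-]; exact: lyapunov_eigenvalue pP Xdec Xl.
Qed.

End SpectralRadius.

(** * Block vectors and block triangular matrices *)

Section Blocks.
Variable R : realType.

Definition vblk N n (x : 'cV[R]_(N * n)) (k : 'I_N) : 'cV[R]_n :=
  \col_a x (mxtens_index (k, a)) 0.

Definition of_blocks N n (f : 'I_N -> 'cV[R]_n) : 'cV[R]_(N * n) :=
  \col_i f (mxtens_unindex i).1 (mxtens_unindex i).2 0.

Lemma vblk_of_blocks N n (f : 'I_N -> 'cV[R]_n) k : vblk (of_blocks f) k = f k.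
Proof. by apply/colP => a; rewrite !mxE mxtens_indexK. Qed.

Lemma vblkP N n (x y : 'cV[R]_(N * n)) : vblk x =1 vblk y -> x = y.
Proof.
move=> xy; apply/colP => i; case: (mxtens_indexP i) => k a.
by have /colP/(_ a) := xy k; rewrite !mxE.
Qed.

Lemma blkP r c m p (M M' : 'M[R]_(r * m, c * p)) :
  (forall k j, blk M k j = blk M' k j) -> M = M'.
Proof.
move=> MM'; apply/matrixP => i j.
case: (mxtens_indexP i) => k a; case: (mxtens_indexP j) => l b.
by have /matrixP/(_ a b) := MM' k l; rewrite !mxE.
Qed.

Lemma vblk0 N n k : vblk (0 : 'cV[R]_(N * n)) k = 0.
Proof. by apply/colP => a; rewrite !mxE. Qed.

Lemma vblkD N n (x y : 'cV[R]_(N * n)) k : vblk (x + y) k = vblk x k + vblk y k.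
Proof. by apply/colP => a; rewrite !mxE. Qed.

Lemma vblkN N n (x : 'cV[R]_(N * n)) k : vblk (- x) k = - vblk x k.
Proof. by apply/colP => a; rewrite !mxE. Qed.

Lemma sum_mxtens_index N n (V : nmodType) (f : 'I_(N * n) -> V) :
  \sum_i f i = \sum_k \sum_a f (mxtens_index (k, a)).
Proof.
rewrite pair_bigA (reindex (@mxtens_index N n)); last first.
  exists (@mxtens_unindex N n) => i _; [exact: mxtens_indexK|].
  exact: mxtens_unindexK.
by apply: eq_bigr => -[].
Qed.

Lemma dot_blocks N n (x y : 'cV[R]_(N * n)) :
  dot x y = \sum_k dot (vblk x k) (vblk y k).
Proof.
rewrite dotE sum_mxtens_index; apply: eq_bigr => k _.
by rewrite dotE; apply: eq_bigr => a _; rewrite !mxE.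
Qed.

Lemma vblk_mul r c m p (F : 'M[R]_(r * m, c * p)) x k :
  vblk (F *m x) k = \sum_j blk F k j *m vblk x j.
Proof.
apply/colP => a; rewrite !mxE sum_mxtens_index summxE; apply: eq_bigr => j _.
by rewrite mxE; apply: eq_bigr => b _; rewrite !mxE.
Qed.

Lemma blk_mul r l c m q p (F : 'M[R]_(r * m, l * q)) (G : 'M[R]_(l * q, c * p))
  k j : blk (F *m G) k j = \sum_i blk F k i *m blk G i j.
Proof.
apply/matrixP => a b; rewrite !mxE sum_mxtens_index summxE.
apply: eq_bigr => i _; rewrite mxE.
by apply: eq_bigr => d _; rewrite !mxE.
Qed.

Lemma blk_tens r c m p (M : 'M[R]_(r, c)) (A : 'M[R]_(m, p)) k j :
  blk (M *t A) k j = M k j *: A.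
Proof. by apply/matrixP => a b; rewrite mxE tensmxE mxE. Qed.

Lemma tens1mx1 N n : (1%:M : 'M[R]_N) *t (1%:M : 'M[R]_n) = 1%:M.
Proof.
apply: blkP => k l; apply/matrixP => a b; rewrite blk_tens !mxE.
by rewrite (can_eq (@mxtens_indexK N n)) xpair_eqE -natrM mulnb.
Qed.

Lemma vblk_tens r c m p (M : 'M[R]_(r, c)) (A : 'M[R]_(m, p)) x k :
  vblk ((M *t A) *m x) k = \sum_j M k j *: (A *m vblk x j).
Proof.
by rewrite vblk_mul; apply: eq_bigr => j _; rewrite blk_tens scalemxAl.
Qed.

Lemma sum_delta (V : lmodType R) c (f : 'I_c -> V) (P : pred 'I_c) j :
  (forall i, P i = (i == j)) -> \sum_i (P i)%:R *: f i = f j.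
Proof.
move=> Pj; rewrite (bigD1 j) //= Pj eqxx scale1r big1 ?addr0 // => i /negbTE ij.
by rewrite Pj ij scale0r.
Qed.

Lemma vblk_tens1 N m p (A : 'M[R]_(m, p)) x (k : 'I_N) :
  vblk ((1%:M *t A) *m x) k = A *m vblk x k.
Proof.
rewrite vblk_tens; under eq_bigr => j _ do rewrite mxE.
by apply: (@sum_delta _ _ _ (fun j => k == j)) => j; rewrite eq_sym.
Qed.

Lemma vblk_Lmx_tens K m p (A : 'M[R]_(m, p)) x (k : 'I_K) :
  vblk ((Lmx R K *t A) *m x) k = A *m vblk x (widen_ord (leqnSn K) k).
Proof.
rewrite vblk_tens; under eq_bigr => j _ do rewrite mxE.
exact: (@sum_delta _ _ _ (fun j : 'I_K.+1 => j == k :> nat)).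
Qed.

Lemma vblk_Rmx_tens K m p (A : 'M[R]_(m, p)) x (k : 'I_K) :
  vblk ((Rmx R K *t A) *m x) k = A *m vblk x (lift ord0 k).
Proof.
rewrite vblk_tens; under eq_bigr => j _ do rewrite mxE.
exact: (@sum_delta _ _ _ (fun j : 'I_K.+1 => j == k.+1 :> nat)).
Qed.

Lemma block_upperM N m q p (F : 'M[R]_(N * m, N * q))
    (G : 'M[R]_(N * q, N * p)) :
  block_upper F -> block_upper G -> block_upper (F *m G).
Proof.
move=> uF uG k j lt_jk; rewrite blk_mul big1 // => i _.
have [lt_ik|le_ki] := ltnP i k; first by rewrite uF ?mul0mx.
by rewrite uG ?mulmx0 // (leq_trans lt_jk).
Qed.

Lemma blk_exchange N m p (F : 'M[R]_(N * m, N * p)) k j :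
  blk ((exchange R N *t 1%:M) *m F *m (exchange R N *t 1%:M)) k j =
  blk F (rev_ord k) (rev_ord j).
Proof.
rewrite blk_mul.
under eq_bigr => i _ do rewrite blk_tens mxE -scalemxAr mulmx1.
rewrite (@sum_delta _ _ _ (fun i => j == rev_ord i) (rev_ord j)); last first.
  by move=> i; rewrite -(inj_eq rev_ord_inj) rev_ordK eq_sym.
rewrite blk_mul.
under eq_bigr => i _ do rewrite blk_tens mxE -scalemxAl mul1mx.
exact: (@sum_delta _ _ _ (fun i => i == rev_ord k)).
Qed.

(** The image U G of U lies in U and has the same rank, hence equals U. *)
Lemma stablemx_invmx n (U G : 'M[R]_n) :
  G \in unitmx -> stablemx U G -> stablemx U (invmx G).
Proof.
move=> uG sUG; have eqr : \rank (U *m G) = \rank U.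
  by rewrite mxrankMfree ?row_free_unit.
have /andP[_] : (U *m G == U)%MS.
  by rewrite -(geq_leqif (mxrank_leqif_eq sUG)) eqr.
by move/(submxMr (invmx G)); rewrite mulmxK.
Qed.

(** A matrix is block upper triangular if and only if, for every t, it maps the
vectors supported on the first t blocks to such vectors; D t is the projection
onto these vectors.  An invertible matrix that preserves a subspace of finite
dimension has an inverse that preserves it. *)
Lemma block_upper_invmx N n (G : 'M[R]_(N * n)) :
  block_upper G -> block_upper (invmx G).
Proof.
(* [invmx] is the identity on singular matrices. *)
have [uG|nuG] := boolP (G \in unitmx); last by rewrite /invmx (negbTE nuG).
pose D t : 'M[R]_(N * n) := diag_mx (\row_(j < N) (j < t)%:R) *t 1%:M.
have DT t : (D t)^T = D t by rewrite trmx_tens tr_diag_mx trmx1.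
have blkD t k j : blk (D t) k j = ((j < t)%:R *+ (k == j)) *: 1%:M.
  by rewrite blk_tens mxE mxE; case: eqP => [->|].
have blkMD t M k j : blk (M *m D t) k j = (j < t)%:R *: blk M k j.
  rewrite blk_mul (bigD1 j) //= blkD eqxx -scalemxAr mulmx1 big1 ?addr0 // => i.
  by move=> /negbTE ij; rewrite blkD ij scale0r mulmx0.
have blkDM t M k j : blk (D t *m M) k j = (k < t)%:R *: blk M k j.
  rewrite blk_mul (bigD1 k) //= blkD eqxx -scalemxAl mul1mx big1 ?addr0 // => i.
  by move=> /negbTE ik; rewrite blkD eq_sym ik scale0r mul0mx.
have DD t : D t *m D t = D t.
  apply: blkP => k j; rewrite blkMD blkD.
  by case: eqP => _; case: ltnP; rewrite /= ?scale1r ?scale0r ?mulr0n ?scaler0.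
have stableP t M : (stablemx (D t) M^T) <-> D t *m M *m D t = M *m D t.
  split=> [/submxP[X /(congr1 trmx)]|eqM].
    rewrite !trmx_mul trmxK DT => MD.
    by rewrite -mulmxA MD mulmxA DD.
  apply/submxP; exists (D t *m M^T).
  by apply: trmx_inj; rewrite !trmx_mul trmxK DT mulmxA.
move=> upG k j lt_jk.
have /stableP : stablemx (D k) (invmx G)^T.
  rewrite trmx_inv stablemx_invmx ?unitmx_tr //; apply/stableP/blkP => i l.
  rewrite -mulmxA blkDM blkMD.
  case: ltnP => [lt_ik|le_ki]; first by rewrite scale1r.
  case: ltnP => [lt_lk|]; rewrite ?scale0r //.
  by rewrite upG ?scaler0 // (leq_trans lt_lk).
move/(congr1 (fun M => blk M k j)); rewrite -mulmxA blkDM ltnn scale0r blkMD.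
by rewrite lt_jk scale1r.
Qed.

Lemma block_lower_sf_gain N n m (J : 'M[R]_(N * m, N * n)) (G : 'M[R]_(N * n)) :
  block_upper J -> block_upper G -> block_lower (sf_gain J G).
Proof.
move=> uJ uG k j lt_kj; rewrite /sf_gain -(mulmxA _ J) blk_exchange.
apply: block_upperM => //; first exact: block_upper_invmx.
by rewrite /= ltn_sub2l // (leq_ltn_trans lt_kj).
Qed.

End Blocks.

(** * Closed-loop trajectories over one period *)

Section ClosedLoop.
Variables (R : realType) (K n m : nat).

(** The cast in [Pi_mx] merely identifies index types, so that a first block is
prepended to a block vector. *)
Lemma vblk_cast_col N (v : 'cV[R]_(1 * n)) (w : 'cV[R]_(N * n)) :
  let y := castmx (esym (mulnDl 1 N n), erefl 1%N) (col_mx v w) in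
  vblk y (ord0 : 'I_N.+1) = vblk v ord0 /\
  forall k : 'I_N, vblk y (lift ord0 k : 'I_N.+1) = vblk w k.
Proof.
split=> [|k]; apply/colP => a; rewrite !mxE castmxE /= cast_ord_id.
  rewrite (_ : cast_ord _ _ = lshift (N * n) (mxtens_index (ord0, a))).
    by rewrite col_mxEu.
  exact: val_inj.
rewrite (_ : cast_ord _ _ = rshift (1 * n) (mxtens_index (k, a))).
    by rewrite col_mxEd.
by apply: val_inj; rewrite /= /bump leq0n mulnDl addnA.
Qed.

Section Plant.
Variables (A : 'M[R]_n) (B : 'M[R]_(n, m)).

Lemma vblk_Pi_mx (x : 'cV[R]_(K.+1 * n)) (u : 'cV[R]_(K.+1 * m)) :
  vblk (Pi_mx A B K *m col_mx x u) ord0 = vblk x ord0 /\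
  vblk (Pi_mx A B K *m col_mx x u) ord_max =
    A *m vblk x ord_max + B *m vblk u ord_max.
Proof.
rewrite /Pi_mx -[col_mx x u](castmx_id (erefl, erefl)) -castmx_mul.
rewrite mul_block_col mul0mx addr0.
have [y0 yS] := vblk_cast_col ((evec R ord0)^T *t 1%:M *m x)
  (1%:M *t A *m x + 1%:M *t B *m u).
split.
  rewrite y0 vblk_tens (bigD1 ord0) //= !mxE eqxx scale1r mul1mx big1 ?addr0 //.
  by move=> j /negbTE j0; rewrite !mxE j0 scale0r.
rewrite (_ : ord_max = lift ord0 ord_max) ?yS; last exact: val_inj.
by rewrite vblkD !vblk_tens1.
Qed.

Lemma form_X_mx (P : 'M[R]_n) (y : 'cV[R]_(K.+2 * n)) :
  dot y (X_mx K.+1 P 1 *m y) =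
    dot (vblk y ord_max) (P *m vblk y ord_max) -
    dot (vblk y ord0) (P *m vblk y ord0).
Proof.
have e2 (i k j : 'I_K.+2) :
    (evec R i *m (evec R i)^T) k j = (k == i)%:R * (j == i)%:R.
  by rewrite mxE big_ord1 !mxE !eqxx !andbT.
have Xy k : vblk (X_mx K.+1 P 1 *m y) k =
    (k == ord_max)%:R *: (P *m vblk y ord_max)
    - (k == ord0)%:R *: (P *m vblk y ord0).
  rewrite vblk_tens.
  under eq_bigr => j _ do
    rewrite mxE mxE scale1r !e2 scalerDl scaleNr -!scalerA.
  rewrite big_split /= sumrN addrC -!scaler_sumr.
  by rewrite (@sum_delta _ _ _ _ (pred1 ord0) ord0) //
    (@sum_delta _ _ _ _ (pred1 ord_max) ord_max).
rewrite dot_blocks; under eq_bigr => k _ do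
  rewrite Xy dotDr dotNr !dotZr.
rewrite big_split /= sumrN.
by rewrite (@sum_delta _ R^o _ _ (pred1 ord_max) ord_max) //
  (@sum_delta _ R^o _ _ (pred1 ord0) ord0).
Qed.

Section Gain.
Variables (p : nat) (C : 'M[R]_(p, n)) (F : 'M[R]_(K.+1 * m, K.+1 * p)).
Hypothesis lowF : block_lower F.

Lemma C_mx_kernelP (x : 'cV[R]_(K.+1 * n)) (u : 'cV[R]_(K.+1 * m)) :
  C_mx A B C F *m col_mx x u = 0 <->
  u = F *m ((1%:M *t C) *m x) /\
  forall k : 'I_K, vblk x (lift ord0 k) =
    A *m vblk x (widen_ord (leqnSn K) k) + B *m vblk u (widen_ord (leqnSn K) k).
Proof.
have top : F *m (1%:M *t C) *m x + - (1%:M *t 1%:M) *m u =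
    F *m ((1%:M *t C) *m x) - u.
  rewrite mulNmx mulmxA; congr (_ - _).
  by apply: vblkP => k; rewrite vblk_tens1 mul1mx.
have bot k :
    vblk ((Lmx R K *t A - Rmx R K *t 1%:M) *m x + (Lmx R K *t B) *m u) k =
    A *m vblk x (widen_ord (leqnSn K) k) + B *m vblk u (widen_ord (leqnSn K) k)
     - vblk x (lift ord0 k).
  rewrite mulmxBl !vblkD vblkN !vblk_Lmx_tens vblk_Rmx_tens mul1mx.
  by rewrite addrAC.
rewrite mul_block_col top; split.
  rewrite -(col_mx0 R) => /eq_col_mx[/eqP]; rewrite subr_eq0 => /eqP-> h.
  split=> // k.
  by have := bot k; rewrite h vblk0 => /eqP; rewrite eq_sym subr_eq0 => /eqP.
move=> [uE xS]; rewrite -{1}uE subrr; apply/eqP; rewrite col_mx_eq0 eqxx /=.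
by apply/eqP/vblkP => k; rewrite bot vblk0 xS subrr.
Qed.

(** Causality: block k of F y involves the blocks 0, ..., k of y alone.  The
sum is written with i = k - j, the delay that indexes the gains. *)
Lemma vblk_lower (y : 'cV[R]_(K.+1 * p)) k :
  vblk (F *m y) k = \sum_(0 <= i < k.+1) gain F k i *m vblk y (inord (k - i)).
Proof.
rewrite vblk_mul.
transitivity (\sum_(0 <= j < K.+1) blk F k (inord j) *m vblk y (inord j)).
  by rewrite big_mkord; apply: eq_bigr => j _; rewrite inord_val.
rewrite (big_cat_nat (n := k.+1)) //= [X in _ + X]big_nat_cond.
rewrite [X in _ + X]big1 ?addr0 => [|j].
  rewrite big_nat_rev /=; apply: eq_big_nat => i _.
  by rewrite /gain inord_val add0n subSS.
rewrite andbT => /andP[lt_kj lt_jK].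
by rewrite lowF ?mul0mx // inordK.
Qed.

(** The closed-loop recursion that defines Phi, applied to an initial state.
For k = K the left-hand side is the state at the end of the period, which is
not a block of x but the last block of Pi z. *)
Lemma trajectoryS (x : 'cV[R]_(K.+1 * n)) (x0 : 'cV[R]_n) (k : 'I_K.+1) :
    (forall i, (i <= k)%N -> vblk x (inord i) = Phi A B C F i *m x0) ->
  A *m vblk x k + B *m vblk (F *m ((1%:M *t C) *m x)) k =
    Phi A B C F k.+1 *m x0.
Proof.
move=> xPhi; rewrite PhiS mulmxDl -!mulmxA -xPhi // inord_val.
congr (_ + B *m _).
rewrite vblk_lower mulmx_suml; apply: eq_big_nat => i _.
by rewrite vblk_tens1 -!mulmxA xPhi // leq_subr.
Qed.

Definition trajectory (x0 : 'cV[R]_n) : 'cV[R]_(K.+1 * n + K.+1 * m) :=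
  let x := of_blocks (fun k : 'I_K.+1 => Phi A B C F k *m x0) in
  col_mx x (F *m ((1%:M *t C) *m x)).

Lemma kernel_trajectory (x0 : 'cV[R]_n) : C_mx A B C F *m trajectory x0 = 0.
Proof.
apply/C_mx_kernelP; split=> // k; rewrite (@trajectoryS _ x0) => [|i le_ik].
  by rewrite vblk_of_blocks.
by rewrite vblk_of_blocks inordK // ltnS (leq_trans le_ik (ltnW (ltn_ord k))).
Qed.

(** The feedback law determines the inputs from the states, and by induction the
state equations determine every state from the first one. *)
Lemma kernelE (z : 'cV[R]_(K.+1 * n + K.+1 * m)) :
  C_mx A B C F *m z = 0 -> z = trajectory (vblk (usubmx z) ord0).
Proof.
rewrite -{1}[z]vsubmxK; set x := usubmx z; set u := dsubmx z.
move=> /C_mx_kernelP[uE xS].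
have xPhi k : (k <= K)%N -> vblk x (inord k) = Phi A B C F k *m vblk x ord0.
  elim/ltn_ind: k => -[_ _|k IHk lt_kK].
    by rewrite Phi0 mul1mx; congr (vblk x _); apply: val_inj; rewrite /= inordK.
  rewrite (_ : inord k.+1 = lift ord0 (Ordinal lt_kK)); last first.
    by apply: val_inj; rewrite /= inordK.
  rewrite xS uE (@trajectoryS _ (vblk x ord0)) // => i le_ik.
  by apply: IHk; rewrite ?ltnS // (leq_trans le_ik (ltnW lt_kK)).
have xE : x = of_blocks (fun k : 'I_K.+1 => Phi A B C F k *m vblk x ord0).
  by apply: vblkP => k; rewrite vblk_of_blocks -xPhi ?inord_val // -ltnS.
by rewrite -[LHS]vsubmxK /trajectory -xE -/x -/u {1}uE.
Qed.

Lemma trajectory_eq0 (x0 : 'cV[R]_n) : (trajectory x0 == 0) = (x0 == 0).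
Proof.
apply/eqP/eqP => [|->]; last first.
  rewrite /trajectory (_ : of_blocks _ = 0) ?mulmx0 ?col_mx0 //.
  by apply: vblkP => k; rewrite vblk_of_blocks vblk0 mulmx0.
move=> /(congr1 (fun z => vblk (usubmx z) ord0)).
by rewrite col_mxKu vblk_of_blocks Phi0 mul1mx linear0 vblk0.
Qed.

Lemma form_trajectory (P : 'M[R]_n) (x0 : 'cV[R]_n) :
  let Q := (Pi_mx A B K)^T *m X_mx K.+1 P 1 *m Pi_mx A B K in
  let z := trajectory x0 in
  dot z (Q *m z) = dot x0 (((A_LTI A B C F)^T *m P *m A_LTI A B C F - P) *m x0).
Proof.
rewrite /= -!mulmxA -dot_mull form_X_mx /trajectory.
have [-> ->] := vblk_Pi_mx (of_blocks (fun k : 'I_K.+1 => Phi A B C F k *m x0))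
  (F *m ((1%:M *t C) *m of_blocks (fun k : 'I_K.+1 => Phi A B C F k *m x0))).
rewrite (@trajectoryS _ x0) => [|i le_iK]; last first.
  by rewrite vblk_of_blocks inordK.
rewrite vblk_of_blocks Phi0 mul1mx mulmxBl dotDr dotNr.
by rewrite -!mulmxA -dot_mull.
Qed.

(** The trajectories parametrise the kernel bijectively by the initial state, so
negativity of the form on the kernel is negativity of its pullback. *)
Lemma neg_on_kernelP (P : 'M[R]_n) :
    P^T = P ->
  (negdef ((A_LTI A B C F)^T *m P *m A_LTI A B C F - P) <->
   forall z : 'cV_(K.+1 * n + K.+1 * m), z != 0 -> C_mx A B C F *m z = 0 ->
     dot z ((Pi_mx A B K)^T *m X_mx K.+1 P 1 *m Pi_mx A B K *m z) < 0).
Proof.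
move=> sP; split=> [/negdefP[_ neg] z z0 /kernelE zE|neg].
  by rewrite zE form_trajectory neg // -trajectory_eq0 -zE.
apply/negdefP; split=> [|v v0].
  by rewrite linearB /= !trmx_mul trmxK sP mulmxA.
by rewrite -form_trajectory neg ?trajectory_eq0 ?kernel_trajectory.
Qed.

End Gain.

Lemma H_mxE (F : 'M[R]_(K.+1 * m, K.+1 * n)) : H_mx A B F = C_mx A B 1%:M F.
Proof.
rewrite /H_mx /C_mx; congr (block_mx _ _ _ _).
by rewrite tens1mx1 mulmx1.
Qed.

Lemma tr_X_mx (P : 'M[R]_n) : P^T = P -> (X_mx K.+1 P 1)^T = X_mx K.+1 P 1.
Proof.
by move=> sP; rewrite trmx_tens sP linearD linearN linearZ /= !trmx_mul !trmxK.
Qed.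

End Plant.
End ClosedLoop.

Theorem theorem2 (R : realType) (K n m p : nat)
    (n_gt0 : (0 < n)%N) (m_gt0 : (0 < m)%N) (p_gt0 : (0 < p)%N)
    (A : 'M[R]_n) (B : 'M[R]_(n, m)) (C : 'M[R]_(p, n))
    (Phat : 'M[R]_n) (Jhat : 'M[R]_(K.+1 * m, K.+1 * n))
    (Ghat : 'M[R]_(K.+1 * n)) (Fsf : 'M[R]_(K.+1 * m, K.+1 * n)) :
  sf_LMI_solution A B Phat Jhat Ghat ->
  Fsf = sf_gain Jhat Ghat ->
  (exists (P : 'M[R]_n) (V : 'M[R]_(K.+1 * m + K * n))
          (F : 'M[R]_(K.+1 * m, K.+1 * p)),
     [/\ P^T = P, block_lower F, posdef P &
         negdef ((Pi_mx A B K)^T *m X_mx K.+1 P 1 *m Pi_mx A B K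
                 + He ((H_mx A B Fsf)^T *m V *m C_mx A B C F))])
  <->
  Pset (A_LTI A B 1%:M Fsf) `&` S_SOF A B C K !=set0.
Proof.
move=> [_ upJ upG _] FsfE.
have lowFsf : block_lower Fsf by rewrite FsfE; exact: block_lower_sf_gain.
rewrite H_mxE; split.
  move=> [P [V [F [sP lowF pP /negdefP[_ neg]]]]].
  (* The added term vanishes on the kernel of either factor. *)
  have negH : negdef ((A_LTI A B 1%:M Fsf)^T *m P *m A_LTI A B 1%:M Fsf - P).
    apply/neg_on_kernelP => // z z0 Hz0; have := neg z z0.
    by rewrite form_addHe Hz0 dot0l mulr0 addr0.
  have negC : negdef ((A_LTI A B C F)^T *m P *m A_LTI A B C F - P).
    apply/neg_on_kernelP => // z z0 Cz0; have := neg z z0.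
    by rewrite form_addHe Cz0 mulmx0 dot0r mulr0 addr0.
  exists P; split; first by split.
  exists F; last by split.
  by split=> //; exact: lyapunov_spectral_radius pP negC.
move=> [P [[pP negH] [F [lowF _] [_ negC]]]]; have [sP _] := pP.
have sQ : ((Pi_mx A B K)^T *m X_mx K.+1 P 1 *m Pi_mx A B K)^T =
    (Pi_mx A B K)^T *m X_mx K.+1 P 1 *m Pi_mx A B K.
  by rewrite !trmx_mul trmxK tr_X_mx // mulmxA.
have [V negV] := projection_lemma sQ
  ((neg_on_kernelP A B 1%:M lowFsf sP).1 negH)
  ((neg_on_kernelP A B C lowF sP).1 negC).
by exists P, V, F.
Qed.
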